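(* Let $p+q=m$, $A\in\mathbb{R}^{m\times n}$, $C\in\mathbb{R}^{s\times n}$ ($C$ not necessarily of full rank), $J=\begin{bmatrix} I_p & 0\\ 0& -I_q\end{bmatrix}$, and suppose that $Q=A^{T}JA$ is positive definite and $\mathrm{rank}\begin{pmatrix}A\\ C\end{pmatrix}=n$. Let $P=I-C^{\dagger}C$ and $C^{\ddagger}_{A}=(I-(PQP)^{\dagger}Q)C^{\dagger}$. Let $v=(\mathrm{vec}(A)^T,\mathrm{vec}(C)^T)^T\in\mathbb{R}^{mn+sn}$ and let $\phi$ be the mapping into $\mathbb{R}^{ns}$ given by $\phi(v)=\mathrm{vec}(C^{\ddagger}_{A})$. Then $\phi$ is continuous and Fréchet differentiable at $v$, and its Fréchet derivative is the matrix $$\mathrm{d}\phi(v)=[W(A),\ W(C)],$$ where $$W(A)=-\left[\left((C^{\ddagger}_{A})^{T}\otimes (PQP)^{\dagger}A^{T}J\right)+\left((JAC^{\ddagger}_{A})^{T}\otimes (PQP)^{\dagger}\right)\Pi_{mn}\right],$$ $$W(C)=-\left[\left((C^{\ddagger}_{A})^{T}\otimes C^{\ddagger}_{A}\right)-\left((I-CC^{\dagger})^{T}\otimes C^{\ddagger}_{A}(C^{\dagger})^{T}\right)\Pi_{sn}-\left(\left((C^{\dagger})^{T}QC^{\ddagger}_{A}\right)^{T}\otimes (PQP)^{\dagger}\right)\Pi_{sn}\right].$$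
   Context: $M^{\dagger}$ denotes the Moore–Penrose inverse of a matrix $M$. For $M=[m_1,\dots,m_n]$ with columns $m_i$, $\mathrm{vec}(M)=[m_1^T,\dots,m_n^T]^T$. $M\otimes N=[m_{ij}N]$ is the Kronecker product. $\Pi_{mn}\in\mathbb{R}^{mn\times mn}$ is the vec-permutation matrix, i.e. $\mathrm{vec}(M^T)=\Pi_{mn}\mathrm{vec}(M)$ for every $M\in\mathbb{R}^{m\times n}$ (likewise $\Pi_{sn}$ for $s\times n$ matrices). The value of $\phi$ at a general point $(\mathrm{vec}(\tilde A)^T,\mathrm{vec}(\tilde C)^T)^T$ is $\mathrm{vec}(\tilde C^{\ddagger}_{\tilde A})$, formed from $\tilde A,\tilde C$ by the same formulas.
   Formalization: For C not of full rank the claim fails (A=1, C=0: φ(1,0)=0 but φ(1,ε)=1/ε), so continuity and the Fréchet derivative are proved along perturbations keeping rank C; if rank C = min(s,n), they are proved without restriction. *)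

(* Defs.v *)
From HB Require Import structures.
From mathcomp Require Import all_boot all_order all_algebra.
From mathcomp Require Import mxtens.
From mathcomp Require Import all_classical all_reals all_analysis.
Set Implicit Arguments.
Unset Strict Implicit.
Unset Printing Implicit Defensive.
Import Order.TTheory GRing.Theory Num.Theory.
Import numFieldNormedType.Exports.
Local Open Scope classical_set_scope.
Local Open Scope ring_scope.

Lemma index_allpairs (S T : eqType) (s : seq S) (t : seq T) x y :
  x \in s -> y \in t ->
  index (x, y) [seq (a, b) | a <- s, b <- t]
    = (index x s * size t + index y t)%N.
Proof.
elim: s => //= a s IH; rewrite inE index_cat => xas yt.
case: (altP (x =P a)) xas => [->|ax] /= xs.
  by rewrite map_f // eqxx index_map // => u v [].
case: mapP => [[b _ [eab _]]|_]; first by rewrite eab eqxx in ax.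
rewrite size_map eq_sym (negPf ax) IH //.
by rewrite mulSn addnA.
Qed.

Lemma mxvec_tens_index m n (i : 'I_m) (j : 'I_n) :
  mxvec_index i j = mxtens_index (i, j).
Proof.
apply: val_inj => /=; set k := enum_rank _.
have -> : k = index (i, j) (enum {: 'I_m * 'I_n}) :> nat.
  by rewrite -[X in index X](nth_enum_rank (i, j)) index_uniq ?enum_uniq // -cardE.
rewrite enumT unlock /= /prod_enum index_allpairs ?mem_enum //.
by rewrite !index_enum_ord size_enum_ord.
Qed.

Section Vec.
Context {R : pzRingType}.

(* MathComp's mxvec stacks rows; the transpositions make vec stack columns. *)
Definition vec m n (M : 'M[R]_(m, n)) : 'cV[R]_(n * m) := (mxvec M^T)^T.

Definition unvec m n (x : 'cV[R]_(n * m)) : 'M[R]_(m, n) := (vec_mx x^T)^T.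

Lemma vecK m n : cancel (@vec m n) (@unvec m n).
Proof. by move=> M; rewrite /unvec /vec trmxK mxvecK trmxK. Qed.

Lemma unvecK m n : cancel (@unvec m n) (@vec m n).
Proof. by move=> x; rewrite /unvec /vec trmxK vec_mxK trmxK. Qed.

End Vec.

Section VecPerm.
Context {R : comPzRingType}.

(* The vec-permutation matrix of m x n matrices; it is characterized by
   vec_permP and vec_perm_uniq below. *)
Definition vec_perm m n : 'M[R]_(m * n, n * m) :=
  (lin_mx (@trmx R n m))^T.

Lemma vec_permP m n (M : 'M[R]_(m, n)) : vec M^T = vec_perm m n *m vec M.
Proof.
by rewrite /vec /vec_perm -trmx_mul mul_vec_lin.
Qed.

Lemma vec_perm_uniq m n (S : 'M[R]_(m * n, n * m)) :
  (forall M : 'M[R]_(m, n), vec M^T = S *m vec M) -> S = vec_perm m n.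
Proof.
move=> hS; apply/matrixP => i k.
have h : S *m delta_mx k 0 = vec_perm m n *m delta_mx k (0 : 'I_1).
  by rewrite -[delta_mx k _]unvecK -hS vec_permP.
by move/colP/(_ i): h; rewrite -!colE !mxE.
Qed.

Lemma vec_tens m n p r (A : 'M[R]_(m, n)) (M : 'M[R]_(n, p)) (B : 'M[R]_(p, r)) :
  (B^T *t A) *m vec M = vec (A *m M *m B).
Proof.
apply/colP => k; rewrite /vec; case/mxvec_indexP: k => i j.
rewrite [RHS]mxE mxvecE [RHS]mxE [RHS]mxE [LHS]mxE.
rewrite (reindex _ (curry_mxvec_bij _ _)) /=.
transitivity (\sum_(ab : 'I_p * 'I_n) B ab.1 i * A j ab.2 * M ab.2 ab.1).
  apply: eq_bigr => -[a b] _ /=; rewrite [X in _ * X]mxE mxvecE mxE.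
  by rewrite !mxvec_tens_index !mxtens_indexK [LHS]mulrAC !mxE mulrAC.
rewrite -(pair_bigA _ (fun a b => B a i * A j b * M b a)) /=.
apply: eq_bigr => a _; rewrite mxE mulr_suml; apply: eq_bigr => b _.
by rewrite -mulrA mulrC.
Qed.

End VecPerm.

Section MoorePenrose.
Context {R : realFieldType}.

Lemma gram_unit r n (B : 'M[R]_(r, n)) :
  row_free B -> B *m B^T \in unitmx.
Proof.
move=> fB; rewrite -row_free_unit -kermx_eq0; set K := kermx _.
have K0 : K *m B *m (K *m B)^T = 0.
  by rewrite trmx_mul mulmxA -(mulmxA K) mulmx_ker mul0mx.
rewrite -(inj_eq (row_free_inj fB)) mul0mx; apply/eqP/matrixP => i j.
move/matrixP/(_ i i): K0; rewrite [LHS]mxE [RHS]mxE => /eqP; rewrite psumr_eq0.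
  move=> /allP/(_ j (mem_index_enum _)) /=.
  by rewrite [X in _ * X]mxE mulf_eq0 orbb [RHS]mxE => /eqP.
by move=> k _; rewrite [X in _ * X]mxE -expr2 sqr_ge0.
Qed.

Definition moore_penrose m n (M : 'M[R]_(m, n)) (X : 'M[R]_(n, m)) : Prop :=
  [/\ M *m X *m M = M, X *m M *m X = X,
      (M *m X)^T = M *m X & (X *m M)^T = X *m M].

Lemma moore_penrose_mul m n r (L : 'M[R]_(m, r)) (B : 'M[R]_(r, n)) :
  row_free L^T -> row_free B ->
  moore_penrose (L *m B)
    (B^T *m invmx (B *m B^T) *m (invmx (L^T *m L) *m L^T)).
Proof.
move=> /gram_unit; rewrite trmxK => uL /gram_unit uB.
set Li := invmx (L^T *m L) *m L^T; set Bi := B^T *m invmx (B *m B^T).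
have LiL : Li *m L = 1%:M by rewrite -mulmxA mulVmx.
have BBi : B *m Bi = 1%:M by rewrite mulmxA mulmxV.
have MX : L *m B *m (Bi *m Li) = L *m Li.
  by rewrite mulmxA -(mulmxA L) BBi mulmx1.
have XM : Bi *m Li *m (L *m B) = Bi *m B.
  by rewrite mulmxA -(mulmxA Bi) LiL mulmx1.
split; rewrite ?MX ?XM.
- by rewrite mulmxA -(mulmxA L) LiL mulmx1.
- by rewrite mulmxA -(mulmxA Bi) BBi mulmx1.
- by rewrite /Li !trmx_mul trmx_inv trmx_mul !trmxK mulmxA.
- by rewrite /Bi !trmx_mul trmx_inv trmx_mul !trmxK mulmxA.
Qed.

Lemma moore_penrose_ex m n (M : 'M[R]_(m, n)) : exists X, moore_penrose M X.
Proof.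
rewrite -(mulmx_base M); eexists; apply: moore_penrose_mul.
  by rewrite /row_free mxrank_tr; apply: col_base_full.
exact: row_base_free.
Qed.

Lemma moore_penrose_uniq m n (M : 'M[R]_(m, n)) X Y :
  moore_penrose M X -> moore_penrose M Y -> X = Y.
Proof.
move=> [x1 x2 x3 x4] [y1 y2 y3 y4].
have eMX : M *m X = M *m Y.
  by rewrite -x3 -{1}y1 -(mulmxA _ M X) trmx_mul x3 y3 mulmxA x1.
have eXM : X *m M = Y *m M.
  by rewrite -x4 -{1}y1 -(mulmxA M) mulmxA trmx_mul x4 y4 -mulmxA (mulmxA M) x1.
by rewrite -x2 -mulmxA eMX mulmxA eXM y2.
Qed.
End MoorePenrose.

Section PseudoInverse.
Context {R : realType}.

Definition mpinv m n (M : 'M[R]_(m, n)) : 'M[R]_(n, m) :=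
  xget 0 [set X | moore_penrose M X].

Lemma mpinvP m n (M : 'M[R]_(m, n)) : moore_penrose M (mpinv M).
Proof. exact: (xgetPex 0 (moore_penrose_ex M)). Qed.

End PseudoInverse.

Section IndefiniteLS.
Context {R : realType}.

Definition posdefmx n (M : 'M[R]_n) : Prop :=
  M^T = M /\ forall x : 'cV[R]_n, x != 0 -> 0 < (x^T *m M *m x) 0 0.

Context {p q n s : nat}.
Implicit Types (A : 'M[R]_(p + q, n)) (C : 'M[R]_(s, n)).

Definition Jmx : 'M[R]_(p + q) := block_mx 1%:M 0 0 (- 1%:M).

Definition Qmx A : 'M[R]_n := A^T *m Jmx *m A.

Definition Pmx C : 'M[R]_n := 1%:M - mpinv C *m C.

Definition mpinvPQP A C : 'M[R]_n := mpinv (Pmx C *m Qmx A *m Pmx C).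

Definition ddagger A C : 'M[R]_(n, s) :=
  (1%:M - mpinvPQP A C *m Qmx A) *m mpinv C.

Definition stack A C : 'cV[R]_(n * (p + q) + n * s) := col_mx (vec A) (vec C).

Definition phi (x : 'cV[R]_(n * (p + q) + n * s)) : 'cV[R]_(s * n) :=
  vec (ddagger (unvec (usubmx x)) (unvec (dsubmx x))).

Lemma phiE A C : phi (stack A C) = vec (ddagger A C).
Proof. by rewrite /phi /stack col_mxKu col_mxKd !vecK. Qed.

Definition WA A C : 'M[R]_(s * n, n * (p + q)) :=
  - (((ddagger A C)^T *t (mpinvPQP A C *m A^T *m Jmx))
     + ((Jmx *m A *m ddagger A C)^T *t mpinvPQP A C) *m vec_perm (p + q) n).

Definition WC A C : 'M[R]_(s * n, n * s) :=
  - (((ddagger A C)^T *t ddagger A C)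
     - ((1%:M - C *m mpinv C)^T *t (ddagger A C *m (mpinv C)^T)) *m vec_perm s n
     - (((mpinv C)^T *m Qmx A *m ddagger A C)^T *t mpinvPQP A C)
         *m vec_perm s n).

(* The pseudo-inverse is discontinuous at every C with \rank C < minn s n
   along perturbations that raise the rank, and so is phi; the rank of the
   perturbed C therefore has to be kept. For C of full row or column rank this
   is no restriction near C, since full rank is an open condition. *)
Definition same_rank C : set 'cV[R]_(n * (p + q) + n * s) :=
  [set x | \rank (unvec (dsubmx x) : 'M[R]_(s, n)) = \rank C].

End IndefiniteLS.

Definition frechet_within (R : realType) (V W : normedModType R) (D : set V)
    (f : V -> W) (v : V) (L : {linear V -> W}) : Prop :=
  continuous L /\
  forall x, f x = f v + L (x - v) +o_(x \near within D (nbhs v)) (x - v).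

(* Main.v *)
Require Import Defs.
From HB Require Import structures.
From mathcomp Require Import all_boot all_order all_algebra.
From mathcomp Require Import mxtens ring.
From mathcomp Require Import all_classical all_reals all_analysis.
Import Order.TTheory GRing.Theory Num.Theory.
Import numFieldNormedType.Exports.
Local Open Scope classical_set_scope.
Local Open Scope ring_scope.

(** Write D for the matrix ddagger A C, X for the pseudo-inverse of C, P for
    I - X C and K for the pseudo-inverse of P Q P, and put primes on the same
    matrices formed from a nearby pair (A', C') with \rank C' = \rank C.

    The derivative is read off an exact identity.  As soon as P Q P has the rank
    of P, the matrix K is an inverse of Q compressed to ker C, which makes D a
    weighted pseudo-inverse of C: C D = C X and D C = I - K Q.  These two
    relations turn the trivial splitting
      D' - D = D' (I - C D) - (I - D' C') D - D' (C' - C) D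
    into
      D' - D = D' X'^T (C' - C)^T (I - C X) - K' (Q' - Q) D
               + K' (C' - C)^T X^T Q D - D' (C' - C) D        (ddaggerB),
    an analogue of Wedin's formula for the difference of two pseudo-inverses.
    Vectorized, it reads
      phi v' - phi v = S (v') (v' - v)                        (phi_stackB),
    where S (v') is the matrix [W(A), W(C)] with some of its factors replaced by
    their primed versions.  By Caratheodory's form of differentiability, it then
    only remains to see that S (v') tends to S (v) = [W(A), W(C)].

    This reduces to the continuity of the pseudo-inverse along matrices of
    constant rank (cvg_mpinv), applied once to C and once to P Q P.  It holds
    because a matrix N of rank r close to M factors through r dimensions by
    means of matrices that depend rationally on N, and the pseudo-inverse of
    such a full-rank factorization is an explicit rational expression.  That
    P' Q' P' keeps its rank is automatic: the rank can only jump up, and it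
    cannot exceed \rank P' = \rank P = \rank (P Q P).

    If C has full rank, every C' near C has the same rank, and the restriction
    to a subset of the neighbourhood of v disappears. *)

(** * Pseudo-inverses and the projection onto the kernel *)

Section ProjectedInverse.
Set Implicit Arguments.
Unset Strict Implicit.
Context {R : realType}.

Lemma mpinv_mulK m n (C : 'M[R]_(m, n)) : C *m mpinv C *m C = C.
Proof. by have [] := mpinvP C. Qed.

Lemma mpinv_gram m n (C : 'M[R]_(m, n)) :
  mpinv C *m (mpinv C)^T *m C^T = mpinv C.
Proof. by have [_ h h3 _] := mpinvP C; rewrite -mulmxA -trmx_mul h3 mulmxA. Qed.

Lemma trmx_mul_coproj m n (C : 'M[R]_(m, n)) :
  C^T *m (1%:M - C *m mpinv C) = 0.
Proof.
have [h _ h3 _] := mpinvP C.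
by rewrite mulmxBr mulmx1 -h3 -trmx_mul h subrr.
Qed.

Lemma PmxE m n (C : 'M[R]_(m, n)) : mpinv C *m C = 1%:M - Pmx C.
Proof. by rewrite /Pmx subKr. Qed.

Lemma mul_Pmx m n (C : 'M[R]_(m, n)) : C *m Pmx C = 0.
Proof. by rewrite /Pmx mulmxBr mulmx1 mulmxA mpinv_mulK subrr. Qed.

Lemma trmx_Pmx m n (C : 'M[R]_(m, n)) : (Pmx C)^T = Pmx C.
Proof. by have [_ _ _ h] := mpinvP C; rewrite /Pmx linearB /= trmx1 h. Qed.

Lemma Pmx_tr m n (C : 'M[R]_(m, n)) : Pmx C *m C^T = 0.
Proof. by rewrite -trmx_Pmx -trmx_mul mul_Pmx trmx0. Qed.

Lemma Pmx_idem m n (C : 'M[R]_(m, n)) : Pmx C *m Pmx C = Pmx C.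
Proof. by rewrite {1}/Pmx mulmxBl mul1mx -mulmxA mul_Pmx mulmx0 subr0. Qed.

Lemma rank_Pmx m n (C : 'M[R]_(m, n)) : \rank (Pmx C) = (n - \rank C)%N.
Proof.
have kP : (kermx C^T :=: Pmx C)%MS.
  apply/eqmxP/andP; split; last by apply/sub_kermxP; exact: Pmx_tr.
  have [_ _ _ h] := mpinvP C; apply/submxP; exists (kermx C^T).
  by rewrite /Pmx -h trmx_mul mulmxBr mulmx1 mulmxA mulmx_ker mul0mx subr0.
by rewrite -kP mxrank_ker mxrank_tr.
Qed.

(** K is the inverse of Q compressed to the range of P: since P Q P has the
    rank of P, its row and column spaces are the range of P, so K (P Q P) and
    (P Q P) K, the orthogonal projections onto them, are both P. *)
Lemma projected_mpinv n (P Q : 'M[R]_n) (K := mpinv (P *m Q *m P)) :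
  P^T = P -> P *m P = P -> Q^T = Q -> \rank (P *m Q *m P) = \rank P ->
  [/\ K *m P = K, P *m K = K, K *m Q *m P = P & P *m Q *m K = P].
Proof.
(* M is kept opaque, lest associativity rewrite inside it. *)
have [M eM] : {M | M = P *m Q *m P} by exists (P *m Q *m P).
rewrite /K -eM => {K} Ps PP Qs rM; set K := mpinv M.
have Ms : M^T = M by rewrite eM !trmx_mul Ps Qs mulmxA.
have MP : M *m P = M by rewrite eM -mulmxA PP.
have PM : P *m M = M by rewrite eM !mulmxA PP.
have [M1 M2 M3 M4] := mpinvP M; rewrite -/K in M1 M2 M3 M4.
have KP : K *m P = K.
  have eK : K = K *m K^T *m M by rewrite -{1}Ms -mulmxA -trmx_mul M3 mulmxA.
  by rewrite {1}eK -mulmxA MP -eK.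
have PK : P *m K = K.
  have eK : K = M *m K^T *m K by rewrite -{1}Ms -trmx_mul M4.
  by rewrite {1}eK !mulmxA PM -eK.
have /submxP[Y eP] : (P <= M)%MS.
  have sMP : (M <= P)%MS by rewrite eM submxMl.
  by rewrite -(geq_leqif (mxrank_leqif_sup sMP)) rM.
have KM : K *m M = P by rewrite -{1}PK {1}eP -!mulmxA (mulmxA M) M1 -eP.
have MK : M *m K = P.
  have eP' : P = M *m Y^T by rewrite -{1}Ps {1}eP trmx_mul Ms.
  by rewrite -{1}KP {1}eP' !mulmxA M1 -eP'.
split=> //; first by rewrite -{1}KP -mulmxA -mulmxA (mulmxA P) -eM KM.
by rewrite -{1}PK mulmxA -eM MK.
Qed.

End ProjectedInverse.

(** * The weighted pseudo-inverse and its exact increments *)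

Section WeightedInverse.
Set Implicit Arguments.
Unset Strict Implicit.
Context {R : realType} {p q n s : nat}.
Implicit Types (A : 'M[R]_(p + q, n)) (C : 'M[R]_(s, n)).

Lemma trmx_Jmx : (@Jmx R p q)^T = Jmx.
Proof.
by rewrite /Jmx tr_block_mx !trmx0 linearN /= !trmx1.
Qed.

Lemma trmx_Qmx A : (Qmx A)^T = Qmx A.
Proof. by rewrite /Qmx !trmx_mul trmxK trmx_Jmx mulmxA. Qed.

Lemma QmxB A A' :
  Qmx A' - Qmx A = A'^T *m Jmx *m (A' - A) + (A' - A)^T *m Jmx *m A.
Proof.
by rewrite /Qmx mulmxBr linearB /= !mulmxBl addrA subrK.
Qed.

(** The form Q is nondegenerate on the kernel of C.  This is all that the
    identities below use of the positivity of Q, and being a condition on ranks,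
    it passes to nearby pairs by semicontinuity of the rank. *)
Definition nondegenerate A C : Prop :=
  \rank (Pmx C *m Qmx A *m Pmx C) = \rank (Pmx C).

Lemma posdef_nondegenerate A C : posdefmx (Qmx A) -> nondegenerate A C.
Proof.
move=> [_ Qpos]; apply/eqP; rewrite eqn_leq mxrankM_maxr /=.
suff: (kermx (Pmx C *m Qmx A *m Pmx C) <= kermx (Pmx C))%MS.
  move/mxrankS; rewrite !mxrank_ker leq_subLR => h.
  by rewrite -(leq_add2r (n - \rank (Pmx C))) subnKC ?rank_leq_row.
apply/sub_kermxP/row_matrixP => i; rewrite row_mul row0.
(* Q is positive definite and vanishes on the vector P u^T. *)
set u := row i _.
have hu : u *m (Pmx C *m Qmx A *m Pmx C) = 0.
  by rewrite -row_mul mulmx_ker row0.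
have e : ((u *m Pmx C)^T)^T *m Qmx A *m (u *m Pmx C)^T = 0.
  rewrite trmxK trmx_mul trmx_Pmx !mulmxA in hu *.
  by rewrite hu mul0mx.
apply/eqP/contraT => u0; have := Qpos (u *m Pmx C)^T.
by rewrite e mxE ltxx trmx_eq0 => /(_ u0).
Qed.

(** Applied to a perturbed pair, this puts a factor C'^T = (C' - C)^T + C^T at the
    right end of D'; the C^T part vanishes against I - C X. *)
Lemma ddagger_gram A C : ddagger A C *m (mpinv C)^T *m C^T = ddagger A C.
Proof. by rewrite /ddagger -!mulmxA (mulmxA (mpinv C)) mpinv_gram. Qed.

Lemma nondegenerateP A C (K := mpinvPQP A C) : nondegenerate A C ->
  [/\ K *m Pmx C = K, Pmx C *m K = K, K *m Qmx A *m Pmx C = Pmx C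
    & Pmx C *m Qmx A *m K = Pmx C].
Proof.
exact: projected_mpinv (trmx_Pmx C) (Pmx_idem C) (trmx_Qmx A).
Qed.

Lemma mul_ddagger A C : nondegenerate A C -> C *m ddagger A C = C *m mpinv C.
Proof.
move=> /nondegenerateP[_ PK _ _].
by rewrite /ddagger mulmxA mulmxBr mulmx1 mulmxA -PK !mulmxA mul_Pmx !mul0mx subr0.
Qed.

Lemma ddagger_mul A C : nondegenerate A C ->
  ddagger A C *m C = 1%:M - mpinvPQP A C *m Qmx A.
Proof.
move=> /nondegenerateP[_ _ KQP _].
by rewrite /ddagger -mulmxA PmxE mulmxBr mulmx1 mulmxBl mul1mx KQP subrr subr0.
Qed.

(** The columns of Q D lie in the range of C^T: P Q D = 0 because P Q K = P.
    Together with K' C'^T = 0, this makes K' Q D of first order in C' - C. *)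
Lemma Qmx_ddagger A C : nondegenerate A C ->
  Qmx A *m ddagger A C = C^T *m (mpinv C)^T *m Qmx A *m ddagger A C.
Proof.
move=> /nondegenerateP[_ _ _ PQK].
have -> : C^T *m (mpinv C)^T = 1%:M - Pmx C.
  by rewrite -trmx_mul PmxE linearB /= trmx1 trmx_Pmx.
rewrite mulmxBl mul1mx mulmxBl (_ : Pmx C *m _ *m _ = 0) ?subr0 //.
rewrite /ddagger (mulmxA _ _ (mpinv C)) mulmxBr mulmx1.
by rewrite (mulmxA _ (mpinvPQP A C)) PQK subrr mul0mx.
Qed.

(** The first term is D' (I - C D), the next two are -(I - D' C') D = -K' Q' D
    with Q' split as (Q' - Q) + Q. *)
Lemma ddaggerB A C A' C' : nondegenerate A C -> nondegenerate A' C' ->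
  ddagger A' C' - ddagger A C =
    ddagger A' C' *m (mpinv C')^T *m (C' - C)^T *m (1%:M - C *m mpinv C)
    - mpinvPQP A' C' *m (Qmx A' - Qmx A) *m ddagger A C
    + mpinvPQP A' C' *m (C' - C)^T *m ((mpinv C)^T *m Qmx A *m ddagger A C)
    - ddagger A' C' *m (C' - C) *m ddagger A C.
Proof.
move=> nd nd'; have [K'P' _ _ _] := nondegenerateP nd'.
set D' := ddagger A' C'; set D := ddagger A C; set K' := mpinvPQP A' C' in K'P' *.
rewrite [(C' - C)^T]linearB /=.
have -> : D' *m (mpinv C')^T *m (C'^T - C^T) *m (1%:M - C *m mpinv C)
    = D' - D' *m C *m D.
  rewrite [_ *m (C'^T - C^T)]mulmxBr ddagger_gram mulmxBl -[X in _ - X]mulmxA.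
  by rewrite trmx_mul_coproj mulmx0 subr0 -(mul_ddagger nd) mulmxBr mulmx1 mulmxA.
have -> : K' *m (C'^T - C^T) *m ((mpinv C)^T *m Qmx A *m D) = - (K' *m Qmx A *m D).
  rewrite mulmxBr -{1}K'P' -[K' *m _ *m C'^T]mulmxA Pmx_tr mulmx0.
  rewrite sub0r mulNmx; congr (- _).
  by rewrite -[RHS]mulmxA (Qmx_ddagger nd) !mulmxA.
have -> : K' *m (Qmx A' - Qmx A) *m D = D - D' *m C' *m D - K' *m Qmx A *m D.
  by rewrite ddagger_mul // mulmxBr !mulmxBl mul1mx subKr.
rewrite mulmxBr mulmxBl; move: (D' *m C *m D) (D' *m C' *m D) (K' *m Qmx A *m D).
move=> x y z; rewrite !opprB !addrA.
by apply/matrixP => i j; rewrite !mxE; ring.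
Qed.

(** The coefficients of the increments of A and C in the identity ddaggerB, once
    vectorized; for (A', C') = (A, C) they are WA A C and WC A C. *)
Definition slopeA A C A' C' : 'M[R]_(s * n, n * (p + q)) :=
  - (((ddagger A C)^T *t (mpinvPQP A' C' *m A'^T *m Jmx))
     + ((Jmx *m A *m ddagger A C)^T *t mpinvPQP A' C') *m vec_perm (p + q) n).

Definition slopeC A C A' C' : 'M[R]_(s * n, n * s) :=
  - (((ddagger A C)^T *t ddagger A' C')
     - ((1%:M - C *m mpinv C)^T *t (ddagger A' C' *m (mpinv C')^T))
         *m vec_perm s n
     - (((mpinv C)^T *m Qmx A *m ddagger A C)^T *t mpinvPQP A' C')
         *m vec_perm s n).

Lemma phi_stackB A C A' C' : nondegenerate A C -> nondegenerate A' C' ->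
  phi (stack A' C') - phi (stack A C) =
    row_mx (slopeA A C A' C') (slopeC A C A' C') *m (stack A' C' - stack A C).
Proof.
have vecB m r (M N : 'M[R]_(m, r)) : vec (M - N) = vec M - vec N.
  by rewrite /vec !linearB.
have vecD m r (M N : 'M[R]_(m, r)) : vec (M + N) = vec M + vec N.
  by rewrite /vec !linearD.
move=> nd nd'; rewrite !phiE -vecB ddaggerB // /stack opp_col_mx add_col_mx.
rewrite -!vecB mul_row_col /slopeA /slopeC QmxB.
move: (ddagger A' C') (ddagger A C) (mpinvPQP A' C') (Qmx A) => D' D K' Q.
rewrite !mulNmx !mulmxDl !mulNmx -!mulmxA -!vec_permP !vec_tens.
rewrite !(mulmxDr, mulmxDl) -!mulmxA !(vecB, vecD).
do 5!move: (vec (_ *m _)) => ?.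
by apply/colP => i; rewrite !mxE; ring.
Qed.

End WeightedInverse.

(** * Continuity of the pseudo-inverse at constant rank *)

Section MatrixLimits.
Set Implicit Arguments.
Unset Strict Implicit.
Context {R : realType} {T : Type} {F : set_system T} {FF : Filter F}.

Lemma cvg_mx m n (f : T -> 'M[R]_(m, n)) (M : 'M[R]_(m, n)) :
  (forall i j, f x i j @[x --> F] --> M i j) -> f x @[x --> F] --> M.
Proof.
move=> fM S [P MP PS]; apply: (filterS (P := fun x => forall i j, P i j (f x i j))).
  by move=> x Px; apply: PS.
by apply: filter_forall => i; apply: filter_forall => j; exact: (fM i j _ (MP i j)).
Qed.

Lemma cvg_mx_coord m n (f : T -> 'M[R]_(m, n)) (M : 'M[R]_(m, n)) i j :
  f x @[x --> F] --> M -> f x i j @[x --> F] --> M i j.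
Proof.
move=> fM; apply: (@cvg_comp _ _ _ f (fun N : 'M[R]_(m, n) => N i j) _ _ _ fM).
exact: coord_continuous.
Qed.

Lemma cvg_mulmx m n r (f : T -> 'M[R]_(m, n)) (g : T -> 'M[R]_(n, r))
    (M : 'M[R]_(m, n)) (N : 'M[R]_(n, r)) :
  f x @[x --> F] --> M -> g x @[x --> F] --> N ->
  f x *m g x @[x --> F] --> M *m N.
Proof.
move=> fM gN; apply: cvg_mx => i j; rewrite mxE; under eq_cvg do rewrite mxE.
apply: cvg_big => [|k _]; first exact: add_continuous.
by apply: cvgM; apply: cvg_mx_coord.
Qed.

Lemma cvg_trmx m n (f : T -> 'M[R]_(m, n)) (M : 'M[R]_(m, n)) :
  f x @[x --> F] --> M -> (f x)^T @[x --> F] --> M^T.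
Proof.
move=> fM; apply: cvg_mx => i j; rewrite mxE; under eq_cvg do rewrite mxE.
exact: cvg_mx_coord.
Qed.

Lemma cvg_tensmx m n r k (f : T -> 'M[R]_(m, n)) (g : T -> 'M[R]_(r, k))
    (M : 'M[R]_(m, n)) (N : 'M[R]_(r, k)) :
  f x @[x --> F] --> M -> g x @[x --> F] --> N ->
  (f x *t g x) @[x --> F] --> M *t N.
Proof.
move=> fM gN; apply: cvg_mx => i j; rewrite mxE; under eq_cvg do rewrite mxE.
by apply: cvgM; apply: cvg_mx_coord.
Qed.

Lemma cvg_row_mx m n r (f : T -> 'M[R]_(m, n)) (g : T -> 'M[R]_(m, r))
    (M : 'M[R]_(m, n)) (N : 'M[R]_(m, r)) :
  f x @[x --> F] --> M -> g x @[x --> F] --> N ->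
  row_mx (f x) (g x) @[x --> F] --> row_mx M N.
Proof.
move=> fM gN; apply: cvg_mx => i j; rewrite mxE; under eq_cvg do rewrite mxE.
by case: (fintype.split j) => k; apply: cvg_mx_coord.
Qed.

Lemma cvg_unvec m n (f : T -> 'cV[R]_(n * m)) (v : 'cV[R]_(n * m)) :
  f x @[x --> F] --> v -> unvec (f x) @[x --> F] --> (unvec v : 'M[R]_(m, n)).
Proof.
move=> fv; apply: cvg_mx => i j; rewrite !mxE; under eq_cvg do rewrite !mxE.
exact: cvg_mx_coord.
Qed.

Lemma cvg_determinant n (f : T -> 'M[R]_n) (M : 'M[R]_n) :
  f x @[x --> F] --> M -> \det (f x) @[x --> F] --> \det M.
Proof.
move=> fM; apply: cvg_big => [|s _]; first exact: add_continuous.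
apply: cvgM; first exact: cvg_cst.
apply: cvg_big => [|i _]; first exact: mul_continuous.
exact: cvg_mx_coord.
Qed.

Lemma near_unitmx n (f : T -> 'M[R]_n) (M : 'M[R]_n) :
  f x @[x --> F] --> M -> M \in unitmx -> \forall x \near F, f x \in unitmx.
Proof.
rewrite unitmxE unitfE => /cvg_determinant fM /(cvgr_neq0 _ fM).
by apply: filterS => x; rewrite unitmxE unitfE.
Qed.

Lemma cvg_invmx n (f : T -> 'M[R]_n) (M : 'M[R]_n) :
  M \in unitmx -> f x @[x --> F] --> M ->
  invmx (f x) @[x --> F] --> invmx M.
Proof.
move=> uM fM.
apply: (@cvg_trans _ ((\det (f x))^-1 *: \adj (f x) @[x --> F])).
  apply: near_eq_cvg; have := near_unitmx fM uM.
  by apply: filterS => x ux; rewrite /invmx ux.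
rewrite /invmx uM; apply: cvg_mx => i j; rewrite mxE.
under eq_cvg do rewrite mxE.
apply: cvgM; first by apply: cvgV; [rewrite -unitfE -unitmxE|exact: cvg_determinant].
rewrite mxE; under eq_cvg do rewrite mxE.
apply: cvgM; first exact: cvg_cst.
apply: cvg_determinant; apply: cvg_mx => k l; rewrite !mxE.
under eq_cvg do rewrite !mxE.
exact: cvg_mx_coord.
Qed.

(** A generalized Schur complement vanishes: the rank r of N is already that of
    its compression L^T N B^T, so N has the row space of L^T N. *)
Lemma factor_compress m n r (L : 'M[R]_(m, r)) (B : 'M[R]_(r, n))
    (N : 'M[R]_(m, n)) :
  \rank N = r -> L^T *m N *m B^T \in unitmx ->
  N = N *m B^T *m invmx (L^T *m N *m B^T) *m (L^T *m N).
Proof.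
move=> rN uT; set S := invmx _.
have /submxP[Y eN] : (N <= L^T *m N)%MS.
  have sN : (L^T *m N <= N)%MS by apply: submxMl.
  rewrite -(geq_leqif (mxrank_leqif_sup sN)) rN.
  by rewrite -[leqLHS](mxrank_unit uT) mxrankM_maxl.
by rewrite {1 2}eN -[Y *m _ *m _]mulmxA -(mulmxA Y) mulmxV // mulmx1.
Qed.

(** With L the column base and B the row base of M, the compression is the
    product of the Gram matrices L^T L and B B^T. *)
Lemma compress_unit m n (M : 'M[R]_(m, n)) :
  (col_base M)^T *m M *m (row_base M)^T \in unitmx.
Proof.
have -> : (col_base M)^T *m M *m (row_base M)^T
    = ((col_base M)^T *m col_base M) *m (row_base M *m (row_base M)^T).
  by rewrite mulmxA -(mulmxA _ (col_base M)) mulmx_base.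
rewrite unitmx_mul; apply/andP; split.
  rewrite -{2}[col_base M]trmxK; apply: gram_unit.
  by rewrite /row_free mxrank_tr; apply: col_base_full.
exact/gram_unit/row_base_free.
Qed.

Lemma cvg_compress m n r k (L : 'M[R]_(r, m)) (B : 'M[R]_(n, k))
    (f : T -> 'M[R]_(m, n)) (M : 'M[R]_(m, n)) :
  f x @[x --> F] --> M -> L *m f x *m B @[x --> F] --> L *m M *m B.
Proof. by move=> fM; do 2?apply: cvg_mulmx => //; apply: cvg_cst. Qed.

(** Some compression of M to size \rank M is invertible, which is an open
    condition. *)
Lemma near_rank_ge m n (f : T -> 'M[R]_(m, n)) (M : 'M[R]_(m, n)) :
  f x @[x --> F] --> M -> \forall x \near F, (\rank M <= \rank (f x))%N.
Proof.
move=> /cvg_compress/near_unitmx/(_ (compress_unit M)).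
apply: filterS => x ux; rewrite -[leqLHS](mxrank_unit ux).
exact: leq_trans (mxrankM_maxl _ _) (mxrankM_maxr _ _).
Qed.

Lemma mpinv_factor m n r (U : 'M[R]_(m, r)) (V : 'M[R]_(r, n)) :
  row_free U^T -> row_free V ->
  mpinv (U *m V) = V^T *m invmx (V *m V^T) *m (invmx (U^T *m U) *m U^T).
Proof.
by move=> fU fV; exact: moore_penrose_uniq (mpinvP _) (moore_penrose_mul fU fV).
Qed.

(** Near M and at constant rank, f x = U (f x) *m V (f x) with U and V continuous
    and of full rank, so that the pseudo-inverse of f x is an expression X (f x)
    built from products, transposes and inverses of invertible matrices. *)
Lemma cvg_mpinv m n (f : T -> 'M[R]_(m, n)) (M : 'M[R]_(m, n)) :
  f x @[x --> F] --> M -> (\forall x \near F, \rank (f x) = \rank M) ->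
  mpinv (f x) @[x --> F] --> mpinv M.
Proof.
move=> fM rfM; set L := col_base M; set B := row_base M.
pose V (N : 'M[R]_(m, n)) := L^T *m N.
pose U (N : 'M[R]_(m, n)) := N *m B^T *m invmx (L^T *m N *m B^T).
pose X N := (V N)^T *m invmx (V N *m (V N)^T)
            *m (invmx ((U N)^T *m U N) *m (U N)^T).
have freeV N : L^T *m N *m B^T \in unitmx -> row_free (V N).
  move=> uN; rewrite /row_free eqn_leq rank_leq_row.
  by rewrite -[leqLHS](mxrank_unit uN) mxrankM_maxl.
have freeU N : L^T *m N *m B^T \in unitmx -> row_free (U N)^T.
  move=> uN; have e : L^T *m U N = 1%:M by rewrite /U !mulmxA mulmxV.
  rewrite /row_free mxrank_tr eqn_leq rank_leq_col.
  by rewrite -[leqLHS](mxrank1 R) -e mxrankM_maxr.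
have mpE N : \rank N = \rank M -> L^T *m N *m B^T \in unitmx -> mpinv N = X N.
  move=> rN uN; rewrite {1}(factor_compress rN uN).
  by rewrite mpinv_factor //; [exact: freeU|exact: freeV].
have uM := compress_unit M.
apply: (@cvg_trans _ (X (f x) @[x --> F])).
  apply: near_eq_cvg; have ux := near_unitmx (cvg_compress fM) uM.
  by apply: filterS2 rfM ux => x rx ux; rewrite (mpE _ rx ux).
have cV : V (f x) @[x --> F] --> V M by apply: cvg_mulmx => //; apply: cvg_cst.
have cU : U (f x) @[x --> F] --> U M.
  apply: cvg_mulmx; first by apply: cvg_mulmx => //; apply: cvg_cst.
  by apply: cvg_invmx => //; apply: cvg_compress.
rewrite mpE //; apply: cvg_mulmx.
  apply: cvg_mulmx; first exact: cvg_trmx.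
  apply: cvg_invmx; first exact/gram_unit/freeV.
  by apply: cvg_mulmx => //; apply: cvg_trmx.
apply: cvg_mulmx; last exact: cvg_trmx.
apply: cvg_invmx; last by apply: cvg_mulmx => //; apply: cvg_trmx.
by rewrite -{2}[U M]trmxK; apply/gram_unit/freeU.
Qed.

End MatrixLimits.

(** * Derivatives from slopes *)

Section Derivative.
Set Implicit Arguments.
Unset Strict Implicit.
Context {R : realType}.

Lemma ler_norm_mulmx m n r (M : 'M[R]_(m, n)) (N : 'M[R]_(n, r)) :
  `|M *m N| <= n%:R * `|M| * `|N|.
Proof.
have le_coord k l (Z : 'M[R]_(k, l)) i j : `|Z i j| <= `|Z|.
  by rewrite [leRHS]/Num.Def.normr /= mx_normrE; exact: (le_bigmax _ _ (i, j)).
rewrite [leLHS]/Num.Def.normr /= mx_normrE; apply/bigmax_leP; split=> [|[i j] _ /=].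
  by rewrite !mulr_ge0.
rewrite mxE (le_trans (ler_norm_sum _ _ _)) //.
rewrite (@le_trans _ _ (\sum_(k < n) `|M| * `|N|)) //.
  by apply: ler_sum => k _; rewrite normrM ler_pM.
by rewrite sumr_const card_ord -mulrA mulr_natl.
Qed.

Lemma continuous_mulmx m n r (M : 'M[R]_(m, n)) :
  continuous (mulmx M : 'M[R]_(n, r) -> 'M[R]_(m, r)).
Proof.
move=> N; apply: (@cvg_mulmx _ _ (nbhs N) _ _ _ _ (fun=> M) id).
  exact: cvg_cst.
exact: cvg_id.
Qed.

Lemma slope_cvg m n (F : set_system 'cV[R]_n) {FF : Filter F}
    (f : 'cV[R]_n -> 'cV[R]_m) (S : 'cV[R]_n -> 'M[R]_(m, n))
    (v : 'cV[R]_n) (W : 'M[R]_(m, n)) :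
  F --> v -> (\forall x \near F, f x - f v = S x *m (x - v)) ->
  S x @[x --> F] --> W -> f x @[x --> F] --> f v.
Proof.
move=> Fv fS SW.
apply: (@cvg_trans _ (f v + S x *m (x - v) @[x --> F])).
  by apply: near_eq_cvg; apply: filterS fS => x <-; rewrite addrC subrK.
suff: f v + S x *m (x - v) @[x --> F] --> f v + W *m (v - v).
  by rewrite subrr mulmx0 addr0.
apply: cvgD; first exact: cvg_cst.
by apply: cvg_mulmx => //; apply: cvgB => //; apply: cvg_cst.
Qed.

(** The error f x - f v - W (x - v) is (S x - W) (x - v). *)
Lemma slope_littleo m n (F : set_system 'cV[R]_n) {FF : Filter F}
    (f : 'cV[R]_n -> 'cV[R]_m) (S : 'cV[R]_n -> 'M[R]_(m, n))
    (v : 'cV[R]_n) (W : 'M[R]_(m, n)) :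
  (\forall x \near F, f x - f v = S x *m (x - v)) ->
  S x @[x --> F] --> W ->
  forall e, 0 < e ->
  \forall x \near F, `|f x - (f v + W *m (x - v))| <= e * `|x - v|.
Proof.
move=> fS SW e e0.
(* n.+1 rather than n, so that the quotient makes sense for n = 0. *)
have d0 : 0 < e / n.+1%:R by rewrite divr_gt0.
move/cvgrPdistC_le/(_ _ d0): SW => SW.
apply: filterS2 fS SW => x fx Sx /=.
rewrite opprD addrA fx -mulmxBl (le_trans (ler_norm_mulmx _ _)) //.
rewrite ler_wpM2r //.
apply: (@le_trans _ _ (n.+1%:R * (e / n.+1%:R))).
  by rewrite ler_pM // ler_nat.
by rewrite mulrC divfK.
Qed.

Lemma frechet_slope m n (D : set 'cV[R]_n) (f : 'cV[R]_n -> 'cV[R]_m)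
    (S : 'cV[R]_n -> 'M[R]_(m, n)) (v : 'cV[R]_n) (W : 'M[R]_(m, n)) :
  (\forall x \near within D (nbhs v), f x - f v = S x *m (x - v)) ->
  S x @[x --> within D (nbhs v)] --> W ->
  frechet_within D f v (mulmx W).
Proof.
move=> fS SW; split; first exact: continuous_mulmx.
suff : f = (fun x => f v + W *m (x - v))
            +o_ (within D (nbhs v)) (fun x => x - v).
  by rewrite funeqE.
exact/eqaddoP/(slope_littleo fS SW).
Qed.

Lemma littleo_differentiable (V U : normedModType R) (f : V -> U) (v : V)
    (L : {linear V -> U}) :
  continuous L ->
  (forall e, 0 < e ->
    \forall x \near v, `|f x - (f v + L (x - v))| <= e * `|x - v|) ->
  differentiable f v /\ 'd f v = L :> (V -> U).
Proof.
move=> cL fL.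
have fL0 : f \o shift v = cst (f v) + L +o_ 0 id.
  apply/eqaddoP => e /fL; rewrite (near_shift 0) /=.
  by apply: filterS => h /=; rewrite subr0 addrK.
have dL := diff_unique cL fL0.
by split=> //; apply/diff_locallyP; rewrite dL.
Qed.

End Derivative.

(** * Perturbations that keep the rank of C *)

Section Perturbation.
Set Implicit Arguments.
Unset Strict Implicit.
Context {R : realType} {p q n s : nat}.
Context {A : 'M[R]_(p + q, n)} {C : 'M[R]_(s, n)}.
Context {T : Type} {F : set_system T} {FF : Filter F}.
Context {f : T -> 'M[R]_(p + q, n)} {g : T -> 'M[R]_(s, n)}.
Context (ndAC : nondegenerate A C).
Context (fA : f x @[x --> F] --> A) (gC : g x @[x --> F] --> C).
Context (rgC : \forall x \near F, \rank (g x) = \rank C).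

Lemma cvg_Qmx : Qmx (f x) @[x --> F] --> Qmx A.
Proof.
apply: cvg_mulmx => //; apply: cvg_mulmx; [exact: cvg_trmx | exact: cvg_cst].
Qed.

Lemma cvg_Pmx : Pmx (g x) @[x --> F] --> Pmx C.
Proof.
by apply: cvgB; [exact: cvg_cst | apply: cvg_mulmx => //; exact: cvg_mpinv].
Qed.

Lemma cvg_PQP :
  Pmx (g x) *m Qmx (f x) *m Pmx (g x) @[x --> F] --> Pmx C *m Qmx A *m Pmx C.
Proof.
apply: cvg_mulmx; last exact: cvg_Pmx.
by apply: cvg_mulmx; [exact: cvg_Pmx | exact: cvg_Qmx].
Qed.

(** \rank (P' Q' P') is at least \rank (P Q P) = \rank P by semicontinuity,
    and at most \rank P', which is \rank P since C' has the rank of C. *)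
Lemma near_nondegenerate : \forall x \near F, nondegenerate (f x) (g x).
Proof.
apply: filterS2 rgC (near_rank_ge cvg_PQP) => x rx.
rewrite ndAC => le_r; apply/eqP; rewrite eqn_leq mxrankM_maxr /=.
by rewrite [leqLHS]rank_Pmx rx -rank_Pmx.
Qed.

Lemma cvg_mpinvPQP : mpinvPQP (f x) (g x) @[x --> F] --> mpinvPQP A C.
Proof.
apply: cvg_mpinv; first exact: cvg_PQP.
apply: filterS2 rgC near_nondegenerate => x rx ->.
by rewrite ndAC !rank_Pmx rx.
Qed.

Lemma cvg_ddagger : ddagger (f x) (g x) @[x --> F] --> ddagger A C.
Proof.
apply: cvg_mulmx; last exact: cvg_mpinv.
apply: cvgB; first exact: cvg_cst.
by apply: cvg_mulmx; [exact: cvg_mpinvPQP | exact: cvg_Qmx].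
Qed.

Lemma cvg_slopeA : slopeA A C (f x) (g x) @[x --> F] --> WA A C.
Proof.
apply: cvgN; apply: cvgD.
  apply: cvg_tensmx; first exact: cvg_cst.
  apply: cvg_mulmx; last exact: cvg_cst.
  by apply: cvg_mulmx; [exact: cvg_mpinvPQP | exact: cvg_trmx].
apply: cvg_mulmx; last exact: cvg_cst.
by apply: cvg_tensmx; [exact: cvg_cst | exact: cvg_mpinvPQP].
Qed.

Lemma cvg_slopeC : slopeC A C (f x) (g x) @[x --> F] --> WC A C.
Proof.
apply: cvgN; apply: cvgB; [apply: cvgB|].
- by apply: cvg_tensmx; [exact: cvg_cst | exact: cvg_ddagger].
- apply: cvg_mulmx; last exact: cvg_cst.
  apply: cvg_tensmx; first exact: cvg_cst.
  by apply: cvg_mulmx; [exact: cvg_ddagger | apply/cvg_trmx/cvg_mpinv].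
- apply: cvg_mulmx; last exact: cvg_cst.
  by apply: cvg_tensmx; [exact: cvg_cst | exact: cvg_mpinvPQP].
Qed.

End Perturbation.

Theorem lemma3p1 (R : realType) (p q n s : nat)
    (A : 'M[R]_(p + q, n)) (C : 'M[R]_(s, n))
    (Qpos : posdefmx (Qmx A)) (rankAC : \rank (col_mx A C) = n) :
  let v := stack A C in
  let W := row_mx (WA A C) (WC A C) in
  [/\ phi x @[x --> within (same_rank C) (nbhs v)] --> phi v,
      frechet_within (same_rank C) phi v (mulmx W)
    & \rank C = minn s n ->
      [/\ {for v, continuous phi}, differentiable phi v
        & forall h, 'd phi v h = W *m h]].
Proof.
move=> v W.
have ndAC := posdef_nondegenerate C Qpos.
pose a (x : 'cV[R]_(n * (p + q) + n * s)) : 'M[R]_(p + q, n) := unvec (usubmx x).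
pose c (x : 'cV[R]_(n * (p + q) + n * s)) : 'M[R]_(s, n) := unvec (dsubmx x).
pose S x := row_mx (slopeA A C (a x) (c x)) (slopeC A C (a x) (c x)).
have stackK x : stack (a x) (c x) = x by rewrite /stack !unvecK vsubmxK.
have aA (F : set_system 'cV[R]_(n * (p + q) + n * s)) (FF : Filter F) :
    F --> v -> a x @[x --> F] --> A.
  move=> Fv; rewrite -[A]vecK; apply: cvg_unvec; apply: cvg_mx => i j.
  under eq_cvg do rewrite mxE.
  by rewrite -[vec A](col_mxKu _ (vec C)) mxE; apply: cvg_mx_coord.
have cC (F : set_system 'cV[R]_(n * (p + q) + n * s)) (FF : Filter F) :
    F --> v -> c x @[x --> F] --> C.
  move=> Fv; rewrite -[C]vecK; apply: cvg_unvec; apply: cvg_mx => i j.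
  under eq_cvg do rewrite mxE.
  by rewrite -[vec C](col_mxKd (vec A)) mxE; apply: cvg_mx_coord.
have slope (F : set_system 'cV[R]_(n * (p + q) + n * s)) (FF : Filter F) :
    F --> v -> (\forall x \near F, same_rank C x) ->
    (\forall x \near F, phi x - phi v = S x *m (x - v)) /\
    S x @[x --> F] --> W.
  move=> Fv rF; have {}aA := aA F FF Fv; have {}cC := cC F FF Fv.
  split; last first.
    apply: cvg_row_mx; first exact: (cvg_slopeA ndAC aA cC rF).
    exact: (cvg_slopeC ndAC aA cC rF).
  have nd := near_nondegenerate (FF := FF) ndAC aA cC rF.
  apply: (filterS _ nd) => x ndx.
  by rewrite -{1 3}[x]stackK; apply: phi_stackB.
have FD : Filter (within (same_rank C) (nbhs v)) by exact: within_filter.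
have near_D : \forall x \near within (same_rank C) (nbhs v), same_rank C x.
  exact: withinT.
have [fS SW] := slope _ FD (cvg_within (same_rank C)) near_D.
split; first by apply: (slope_cvg _ fS SW); exact: cvg_within.
  exact: frechet_slope fS SW.
move=> rC.
have rv : \forall x \near v, same_rank C x.
  have {}cC := cC (nbhs v) (nbhs_filter v) (@cvg_id _ _).
  have := near_rank_ge (FF := nbhs_filter v) cC.
  apply: filterS => x; rewrite rC => le_r.
  by apply/eqP; rewrite /= rC eqn_leq leq_min rank_leq_row rank_leq_col.
have {fS SW}[fS SW] := slope (nbhs v) (nbhs_filter v) (@cvg_id _ _) rv.
have [dphi dE] := littleo_differentiable (@continuous_mulmx _ _ _ _ W)
  (slope_littleo fS SW).
split; first exact: differentiable_continuous.
  exact: dphi.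
by move=> h; rewrite dE.
Qed.
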